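(* Let $0\le\alpha<1$, let $K$ be a commutative discrete hypergroup and let $H$ be a finite subgroup of the center $Z(K)$. If $K$ is an $\alpha$-Ramsey hypergroup, then the hypergroup $K//H$ is an $\alpha$-Ramsey hypergroup.
   Context: A discrete hypergroup is a set $K$ (discrete topology) with a map assigning to $m,n\in K$ a finitely supported probability measure $\delta_m*\delta_n$ (extended bilinearly to measures), associative, with identity $e$, and an involution $m\mapsto\check m$ with $(\delta_m*\delta_n)^\vee=\delta_{\check n}*\delta_{\check m}$ and $e\in\operatorname{spt}(\delta_m*\delta_{\check n})$ iff $m=n$; commutative if $\delta_m*\delta_n=\delta_n*\delta_m$. $Z(K)$ is the set of $x\in K$ with $\operatorname{spt}(\delta_x*\delta_y)$ a singleton for all $y$; it is a group. For $x\in K$, $z\in Z(K)$, $xz$ is the unique element of $\operatorname{spt}(\delta_x*\delta_z)$. For a subgroup $H\subset Z(K)$, $K//H=\{xH:x\in K\}$, $xH=\{xz:z\in H\}$, $\pi(x)=[x]=xH$, and $\delta_{[x]}*\delta_{[y]}$ is the image of $\delta_x*\delta_y$ under $\pi$; this makes $K//H$ a hypergroup with identity $[e]$. For an infinite discrete hypergroup $L$ with identity $e$, an injective sequence $\langle x_n\rangle$ in $L\setminus\{e\}$ with range $B$, and nonempty finite $F=\{x_{n_1},\dots,x_{n_m}\}\subset B$ with $n_1<\dots<n_m$, $\delta_F=\delta_{x_{n_1}}*\cdots*\delta_{x_{n_m}}$. $L$ is $\alpha$-Ramsey if for every finite partition $L=\bigcup_{i=1}^rC_i$ there exist $i$ and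 an injective sequence $\langle x_n\rangle$ in $L\setminus\{e\}$ with range $B$ such that $\delta_F(C_i)>\alpha$ for every nonempty finite $F\subset B$. *)

(* Defs.v *)
From HB Require Import structures.
From mathcomp Require Import all_boot all_order all_algebra finmap.
From mathcomp Require Import boolp classical_sets functions cardinality reals.
From mathcomp Require Import monalg.

Set Implicit Arguments.
Unset Strict Implicit.
Unset Printing Implicit Defensive.

Import Order.TTheory GRing.Theory Num.Theory.
Local Open Scope classical_set_scope.
Local Open Scope ring_scope.

(* A finitely supported real measure on K is an element mu of {malg R[K]}:
   << k >> is the point mass at k, mu@_k the mass of the point k, and msupp mu
   the support. *)

Section FiniteMeasures.
Variables (R : realType) (K : choiceType).
Implicit Types (mu nu : {malg R[K]}) (C : set K).

Definition mass mu C : R := \sum_(k <- msupp mu | k \in C) mu@_k.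

Definition probability_malg mu : Prop :=
  (forall k, 0 <= mu@_k) /\ mass mu setT = 1.

(* The linear map sending each point mass << k >> to f k. *)
Definition extend (V : lmodType R) (f : K -> V) mu : V :=
  \sum_(k <- msupp mu) mu@_k *: f k.

Definition convolve (c : K -> K -> {malg R[K]}) mu nu : {malg R[K]} :=
  extend (fun m => extend (c m) nu) mu.

Definition pushforward (T : choiceType) (f : K -> T) : {malg R[K]} -> {malg R[T]} :=
  extend (fun k => << f k >>).

End FiniteMeasures.

Record discreteHypergroup (R : realType) := DiscreteHypergroup {
  hcarrier :> choiceType;
  hconv : hcarrier -> hcarrier -> {malg R[hcarrier]};
  hid : hcarrier;
  hinv : hcarrier -> hcarrier;
  hconv_prob : forall m n, probability_malg (hconv m n);
  hconvA : forall m n p,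
    convolve hconv << m >> (hconv n p) = convolve hconv (hconv m n) << p >>;
  hconv1m : forall m, hconv hid m = << m >>;
  hconvm1 : forall m, hconv m hid = << m >>;
  hinvK : involutive hinv;
  hinv_conv : forall m n,
    pushforward hinv (hconv m n) = hconv (hinv n) (hinv m);
  hid_supp : forall m n, hid \in msupp (hconv m (hinv n)) <-> m = n
}.
Arguments hid {R d}.

Definition hmul (R : realType) (K : discreteHypergroup R) :
    {malg R[K]} -> {malg R[K]} -> {malg R[K]} := convolve (@hconv R K).

Definition commutative_hypergroup (R : realType) (K : discreteHypergroup R) :=
  forall m n : K, hconv m n = hconv n m.

Definition center (R : realType) (K : discreteHypergroup R) : set K :=
  [set x | forall y, exists k : K, msupp (hconv x y) = [fset k]%fset].
Arguments center {R} K.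

(* xz; the default value hid is irrelevant when z is central. *)
Definition cmul (R : realType) (K : discreteHypergroup R) (x z : K) : K :=
  xget hid [set k | msupp (hconv x z) = [fset k]%fset].

(* The group inverse of z in the center is hinv z: see cmulzV below. *)
Record central_subgroup (R : realType) (K : discreteHypergroup R) (H : set K) :
    Prop := CentralSubgroup {
  csubP : H `<=` center K;
  csub1 : H hid;
  csubM : forall z w, H z -> H w -> H (cmul z w);
  csubV : forall z, H z -> H (hinv z)
}.

Definition coset (R : realType) (K : discreteHypergroup R) (H : set K) (x : K) :
  set K := [set cmul x z | z in H].

Definition cosets (R : realType) (K : discreteHypergroup R) (H : set K) :
  set (set K) := range (coset H).

Definition coset_pi (R : realType) (K : discreteHypergroup R) (H : set K)
    (x : K) : cosets H :=
  SigSub (mem_set (imageT (coset H) x)).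

Definition coset_rep (R : realType) (K : discreteHypergroup R) (H : set K)
    (q : cosets H) : K := xget hid [set x | coset_pi H x = q].

(* Independence of the representatives: see qconvE and qinvE below. *)
Definition qconv (R : realType) (K : discreteHypergroup R) (H : set K)
    (p q : cosets H) : {malg R[cosets H]} :=
  pushforward (coset_pi H) (hconv (coset_rep p) (coset_rep q)).

Definition qinv (R : realType) (K : discreteHypergroup R) (H : set K)
    (q : cosets H) : cosets H := coset_pi H (hinv (coset_rep q)).

Section ExtendTheory.
Variables (R : realType) (K : choiceType).
Implicit Types (mu nu : {malg R[K]}).

Lemma extendEw (V : lmodType R) (f : K -> V) (D : {fset K}) mu :
  (msupp mu `<=` D)%fset -> extend f mu = \sum_(k <- D) mu@_k *: f k.
Proof.
move=> sD; rewrite /extend (big_fset_incl _ sD) // => k _ /mcoeff_outdom ->.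
by rewrite scale0r.
Qed.

Lemma extend_linear (V : lmodType R) (f : K -> V) : linear (extend f).
Proof.
move=> a mu nu; pose D := (msupp (a *: mu + nu) `|` (msupp mu `|` msupp nu))%fset.
rewrite (@extendEw _ f D (_ + _)) ?fsubsetUl //.
rewrite (@extendEw _ f D mu); last by rewrite fsubsetU // fsubsetUl orbT.
rewrite (@extendEw _ f D nu); last by rewrite fsubsetU // fsubsetUr orbT.
rewrite scaler_sumr -big_split; apply: eq_bigr => k _ /=.
by rewrite mcoeffD mcoeffZ scalerDl scalerA.
Qed.

HB.instance Definition _ (V : lmodType R) (f : K -> V) :=
  GRing.isLinear.Build R {malg R[K]} V *:%R (extend f) (extend_linear f).

Lemma extendU (V : lmodType R) (f : K -> V) k : extend f << k >> = f k.
Proof.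
by rewrite (@extendEw _ f [fset k]%fset) ?msuppU_le // big_seq_fset1 mcoeffUU scale1r.
Qed.

Lemma malg_sum mu : mu = \sum_(k <- msupp mu) mu@_k *: << k >>.
Proof.
rewrite {1}[mu]monalgE; apply: eq_bigr => k _; apply/malgP => j.
by rewrite mcoeffZ !mcoeffU mulrnAr mulr1.
Qed.

Lemma linear_malg_ext (V : lmodType R) (f g : {malg R[K]} -> V) :
  linear f -> linear g -> (forall k, f << k >> = g << k >>) -> f =1 g.
Proof.
move=> lf lg fg mu.
pose F := HB.pack_for {linear {malg R[K]} -> V} f
  (GRing.isLinear.Build R {malg R[K]} V *:%R f lf).
pose G := HB.pack_for {linear {malg R[K]} -> V} g
  (GRing.isLinear.Build R {malg R[K]} V *:%R g lg).
rewrite (malg_sum mu) -[f]/(F : _ -> _) -[g]/(G : _ -> _) !linear_sum.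
by apply: eq_bigr => k _; rewrite !linearZ /= fg.
Qed.

Lemma massE mu C : mass mu C = extend (fun k => (k \in C)%:R : R^o) mu.
Proof.
rewrite /mass big_mkcond; apply: eq_bigr => k _ /=.
by case: (k \in C); rewrite /GRing.scale /= ?mulr1 ?mulr0.
Qed.

Lemma mass_linear C : linear (fun mu => mass mu C : R^o).
Proof. by move=> a mu nu /=; rewrite !massE linearP. Qed.

Lemma probability_massU k : mass (<< k >> : {malg R[K]}) setT = 1.
Proof. by rewrite massE extendU in_setT. Qed.

Lemma probability_msupp1 mu k :
  probability_malg mu -> msupp mu = [fset k]%fset -> mu = << k >>.
Proof.
move=> [_]; rewrite /mass => + sE; rewrite sE.
under eq_bigl do rewrite in_setT.
rewrite big_seq_fset1 => mk.
by rewrite [LHS]malg_sum sE big_seq_fset1 mk scale1r.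
Qed.

Section Convolve.
Variable c : K -> K -> {malg R[K]}.

Lemma convolveDl nu : linear (fun mu => convolve c mu nu).
Proof. by move=> a mu mu'; rewrite /convolve linearP. Qed.

Lemma convolveDr mu : linear (convolve c mu).
Proof.
move=> a nu nu'; rewrite /convolve {1 3 5}/extend scaler_sumr -big_split /=.
by apply: eq_bigr => k _; rewrite linearP scalerDr !scalerA mulrC.
Qed.

Lemma convolveU m n : convolve c << m >> << n >> = c m n.
Proof. by rewrite /convolve !extendU. Qed.

End Convolve.

End ExtendTheory.

Section PushforwardTheory.
Variables (R : realType) (K : choiceType).
Implicit Types (mu nu : {malg R[K]}).

Lemma pushforward_linear (T : choiceType) (f : K -> T) :
  linear (@pushforward R _ _ f).
Proof. exact: extend_linear. Qed.

Lemma pushforwardU (T : choiceType) (f : K -> T) k :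
  pushforward f (<< k >> : {malg R[K]}) = << f k >>.
Proof. exact: extendU. Qed.

Lemma pushforward_coeff (T : choiceType) (f : K -> T) mu t :
  (pushforward f mu)@_t = \sum_(k <- msupp mu | f k == t) mu@_k.
Proof.
rewrite /pushforward /extend raddf_sum [RHS]big_mkcond; apply: eq_bigr => k _ /=.
by rewrite mcoeffZ mcoeffU; case: (f k == t); rewrite ?mulr1 ?mulr0.
Qed.

Lemma pushforward_mass (T : choiceType) (f : K -> T) mu C :
  mass (pushforward f mu) C = mass mu (f @^-1` C).
Proof.
rewrite !massE.
refine (@linear_malg_ext R K R^o (fun mu' =>
  extend (fun t => (t \in C)%:R : R^o) (pushforward f mu')) _ _ _ _ mu).
- by move=> a mu' nu; rewrite /pushforward !linearP.
- exact: extend_linear.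
- by move=> k; rewrite pushforwardU !extendU; congr (_%:R); apply/idP/idP;
    rewrite !inE.
Qed.

Lemma pushforward_ge0 (T : choiceType) (f : K -> T) mu :
  (forall k, 0 <= mu@_k) -> forall t, 0 <= (pushforward f mu)@_t.
Proof. by move=> mu0 t; rewrite pushforward_coeff sumr_ge0. Qed.

Lemma pushforward_supp (T : choiceType) (f : K -> T) mu t :
  (forall k, 0 <= mu@_k) ->
  t \in msupp (pushforward f mu) <-> exists2 k, k \in msupp mu & f k = t.
Proof.
move=> mu0; rewrite -mcoeff_neq0 pushforward_coeff; split.
- have [//|ne] := pselect (exists2 k, k \in msupp mu & f k = t).
  rewrite big_seq_cond big1 ?eqxx// => k /andP[ks /eqP fk].
  by case: ne; exists k.
- move=> [k ks fk]; rewrite psumr_neq0//.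
  by apply/hasP; exists k => //; rewrite fk eqxx lt_def mcoeff_neq0 ks mu0.
Qed.

Lemma pushforward_prob (T : choiceType) (f : K -> T) mu :
  probability_malg mu -> probability_malg (pushforward f mu).
Proof.
move=> [mu0 mu1]; split; first exact: pushforward_ge0.
by rewrite pushforward_mass preimage_setT.
Qed.

End PushforwardTheory.

Section HypergroupTheory.
Variables (R : realType) (K : discreteHypergroup R).
Implicit Types (mu nu : {malg R[K]}) (x y z w : K).

Lemma hmulDl nu : linear (fun mu => hmul mu nu).
Proof. exact: convolveDl. Qed.

Lemma hmulDr mu : linear (hmul mu).
Proof. exact: convolveDr. Qed.

Lemma hmulU x y : hmul << x >> << y >> = hconv x y.
Proof. exact: convolveU. Qed.

Lemma hmulA : associative (@hmul R K).
Proof.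
move=> mu nu xi; move: mu; apply: linear_malg_ext => [| |x].
- exact: hmulDl.
- by move=> a mu mu'; rewrite !hmulDl.
move: nu; apply: linear_malg_ext => [| |y].
- by move=> a nu nu'; rewrite hmulDl hmulDr.
- by move=> a nu nu'; rewrite hmulDr hmulDl.
move: xi; apply: linear_malg_ext => [| |z].
- by move=> a xi xi'; rewrite !hmulDr.
- exact: hmulDr.
by rewrite !hmulU; apply: hconvA.
Qed.

Lemma hmul1m : left_id << hid >> (@hmul R K).
Proof.
apply: linear_malg_ext => [| |x]; [exact: hmulDr | by [] |].
by rewrite hmulU hconv1m.
Qed.

Lemma hmulm1 : right_id << hid >> (@hmul R K).
Proof.
apply: linear_malg_ext => [| |x]; [exact: hmulDl | by [] |].
by rewrite hmulU hconvm1.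
Qed.

HB.instance Definition _ :=
  Monoid.isLaw.Build {malg R[K]} << hid >> (@hmul R K) hmulA hmul1m hmulm1.

Lemma malgU_inj : injective (fun k : K => << k >> : {malg R[K]}).
Proof.
move=> x y /(congr1 (fun mu => x \in msupp mu)).
by rewrite !msuppU oner_eq0 !inE eqxx => /esym/eqP.
Qed.

Hypothesis commK : commutative_hypergroup K.

Lemma hmulC : commutative (@hmul R K).
Proof.
move=> mu nu; move: mu; apply: linear_malg_ext => [| |x].
- exact: hmulDl.
- exact: hmulDr.
move: nu; apply: linear_malg_ext => [| |y].
- exact: hmulDr.
- exact: hmulDl.
by rewrite !hmulU commK.
Qed.

Lemma cmulE x z : center K z -> hconv x z = << cmul x z >>.
Proof.
move=> /(_ x)[k]; rewrite commK => sk.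
apply: probability_msupp1; first exact: hconv_prob.
exact: (@xgetPex _ hid [set k | msupp (hconv x z) = [fset k]%fset] (ex_intro _ k sk)).
Qed.

Lemma cmulzV z : center K z -> cmul z (hinv z) = hid.
Proof.
move=> cz; have [k sk] := cz (hinv z).
have /eqP : cmul z (hinv z) = k.
  have ex : exists k, msupp (hconv z (hinv z)) = [fset k]%fset by exists k.
  have := xgetPex hid ex; rewrite -/(cmul _ _) /= sk => /fset1_inj; exact.
have : hid \in msupp (hconv z (hinv z)) by apply/hid_supp.
by rewrite sk inE => /eqP-> /eqP.
Qed.

Lemma cmulx1 x : cmul x hid = x.
Proof.
have ex : exists k, msupp (hconv x hid) = [fset k]%fset.
  by exists x; rewrite hconvm1 msuppU oner_eq0.
have := xgetPex hid ex; rewrite -/(cmul _ _) /= hconvm1 msuppU oner_eq0.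
by move=> /fset1_inj.
Qed.

Variable H : set K.
Hypothesis subH : central_subgroup H.
Local Notation pi := (coset_pi H).

Lemma hmulH x z : H z -> hmul << x >> << z >> = << cmul x z >>.
Proof. by move=> Hz; rewrite hmulU cmulE//; exact: (csubP subH). Qed.

Lemma cmulA x z w : H z -> H w -> cmul x (cmul z w) = cmul (cmul x z) w.
Proof.
move=> Hz Hw; apply: malgU_inj => /=.
rewrite -(hmulH _ (csubM subH Hz Hw)) -(hmulH z Hw) hmulA (hmulH x Hz).
by rewrite hmulH.
Qed.

Lemma cmulVK x z : H z -> cmul (cmul x z) (hinv z) = x.
Proof.
move=> Hz; rewrite -cmulA//; last exact: (csubV subH).
by rewrite cmulzV ?cmulx1//; exact: (csubP subH).
Qed.

Lemma coset_cmul x z : H z -> coset H (cmul x z) = coset H x.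
Proof.
move=> Hz; apply/seteqP; split=> _ [w Hw <-].
- by exists (cmul z w); [exact: (csubM subH) | rewrite cmulA].
- have HV := csubV subH Hz.
  exists (cmul (hinv z) w); first exact: (csubM subH).
  by rewrite cmulA// cmulVK.
Qed.

Lemma coset_piP x y : pi x = pi y <-> exists2 z, H z & x = cmul y z.
Proof.
split=> [/(congr1 val)/= xy|[z Hz ->]].
- have : coset H x x by exists hid; [exact: (csub1 subH) | exact: cmulx1].
  by rewrite xy => -[z Hz <-]; exists z.
- by apply: val_inj => /=; exact: coset_cmul.
Qed.

Lemma coset_repK q : pi (coset_rep q) = q.
Proof.
have ex : exists x, pi x = q.
  case: q => A pA; have := set_mem pA => -[x _ xA].
  by exists x; apply: val_inj.
exact: (xgetPex hid ex).
Qed.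

Lemma coset_repP x : exists2 z, H z & coset_rep (pi x) = cmul x z.
Proof. by apply/coset_piP; rewrite coset_repK. Qed.

Lemma pushforward_hmulH mu z : H z ->
  pushforward pi (hmul mu << z >>) = pushforward pi mu.
Proof.
move=> Hz; move: mu; apply: linear_malg_ext => [| |x].
- by move=> a mu mu'; rewrite hmulDl pushforward_linear.
- exact: pushforward_linear.
have px : pi (cmul x z) = pi x by apply/coset_piP; exists z.
by rewrite (hmulH x Hz) (pushforwardU R pi (cmul x z)) (pushforwardU R pi x) px.
Qed.

Lemma qconvE x y : qconv (pi x) (pi y) = pushforward pi (hconv x y).
Proof.
rewrite /qconv; have [z Hz ->] := coset_repP x; have [w Hw ->] := coset_repP y.
rewrite -hmulU -(hmulH x Hz) -(hmulH y Hw) hmulA (pushforward_hmulH _ Hw).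
rewrite hmulC hmulA (pushforward_hmulH _ Hz).
by rewrite hmulC hmulU.
Qed.

Lemma hinv_cmul x z : H z -> hinv (cmul x z) = cmul (hinv x) (hinv z).
Proof.
move=> Hz; apply: malgU_inj => /=.
rewrite -(pushforwardU R (@hinv R K)) -(hmulH x Hz) hmulU hinv_conv commK.
by rewrite -hmulU hmulH//; exact: (csubV subH).
Qed.

Lemma qinvE x : qinv (pi x) = pi (hinv x).
Proof.
rewrite /qinv; have [z Hz ->] := coset_repP x.
by apply/coset_piP; exists (hinv z); [exact: (csubV subH) | exact: hinv_cmul].
Qed.

Lemma pushforward_hmul mu nu :
  pushforward pi (hmul mu nu) =
  convolve (@qconv R K H) (pushforward pi mu) (pushforward pi nu).
Proof.
move: mu; apply: linear_malg_ext => [| |x].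
- by move=> a mu mu'; rewrite hmulDl pushforward_linear.
- by move=> a mu mu'; rewrite pushforward_linear convolveDl.
move: nu; apply: linear_malg_ext => [| |y].
- by move=> a nu nu'; rewrite hmulDr pushforward_linear.
- by move=> a nu nu'; rewrite pushforward_linear convolveDr.
by rewrite !pushforwardU convolveU hmulU qconvE.
Qed.

Lemma qconv_prob p q : probability_malg (@qconv R K H p q).
Proof. exact/pushforward_prob/hconv_prob. Qed.

Lemma qconvA p q r :
  convolve (@qconv R K H) << p >> (qconv q r) =
  convolve (@qconv R K H) (qconv p q) << r >>.
Proof.
rewrite -(coset_repK p) -(coset_repK q) -(coset_repK r).
move: (coset_rep p) (coset_rep q) (coset_rep r) => x y z.
rewrite (qconvE x y) (qconvE y z).
rewrite -(pushforwardU R pi x) -(pushforwardU R pi z).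
refine (etrans (esym (pushforward_hmul << x >> (hconv y z))) _).
refine (etrans _ (pushforward_hmul (hconv x y) << z >>)).
by rewrite -(hmulU x y) -(hmulU y z) hmulA.
Qed.

Lemma qconv1m p : qconv (pi hid) p = << p >>.
Proof. by rewrite -(coset_repK p) qconvE hconv1m (pushforwardU R pi). Qed.

Lemma qconvm1 p : qconv p (pi hid) = << p >>.
Proof. by rewrite -(coset_repK p) qconvE hconvm1 (pushforwardU R pi). Qed.

Lemma qinvK : involutive (@qinv R K H).
Proof. by move=> p; rewrite -(coset_repK p) !qinvE hinvK. Qed.

Lemma qinv_conv p q :
  pushforward (@qinv R K H) (qconv p q) = qconv (qinv q) (qinv p).
Proof.
rewrite -(coset_repK p) -(coset_repK q) !qinvE !qconvE -hinv_conv.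
move: (hconv _ _); apply: linear_malg_ext => [| |x].
- by move=> a mu nu; rewrite !pushforward_linear.
- by move=> a mu nu; rewrite !pushforward_linear.
rewrite (pushforwardU R pi x) (pushforwardU R _ (pi x)) qinvE.
by rewrite (pushforwardU R (@hinv R K) x) (pushforwardU R pi).
Qed.

Lemma hconv_ge0 x y k : 0 <= (hconv x y)@_k.
Proof. by have [+ _] := hconv_prob x y; apply. Qed.

Lemma qid_supp p q : pi hid \in msupp (qconv p (qinv q)) <-> p = q.
Proof.
rewrite -(coset_repK p) -(coset_repK q); move: (coset_rep p) (coset_rep q) => x y.
rewrite qinvE qconvE; split.
- move=> /(pushforward_supp _ _ (hconv_ge0 _ _))[k ks].
  move=> /coset_piP[z Hz]; rewrite -[z]hinvK.
  have -> : cmul hid (hinv (hinv z)) = z.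
    by apply: malgU_inj; rewrite hinvK -hmulH// hmul1m.
  move=> kz; apply/coset_piP; exists z => //; apply/hid_supp.
  have HV := csubV subH Hz.
  have -> : hconv x (hinv (cmul y z)) =
            pushforward (fun k => cmul k (hinv z)) (hconv x (hinv y)).
    rewrite hinv_cmul// -hmulU -hmulH// hmulA hmulU.
    move: (hconv _ _); apply: linear_malg_ext => [| |j].
    + exact: hmulDl.
    + exact: pushforward_linear.
    + by rewrite hmulH// pushforwardU.
  apply/(pushforward_supp _ _ (hconv_ge0 _ _)); exists k => //.
  by rewrite kz cmulzV//; exact: (csubP subH).
- move=> xy; rewrite -qconvE -qinvE -xy qinvE qconvE.
  apply/(pushforward_supp _ _ (hconv_ge0 _ _)); exists hid => //.
  exact/hid_supp.
Qed.

Definition quotient_hypergroup : discreteHypergroup R :=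
  @DiscreteHypergroup R (cosets H) (@qconv R K H) (pi hid) (@qinv R K H)
    qconv_prob qconvA qconv1m qconvm1 qinvK qinv_conv qid_supp.

End HypergroupTheory.

(* delta_F for F = {x_n | n in s}, where s is the increasing list of indices
   n_1 < ... < n_m; the identity << hid >> is only the end of the product. *)
Definition delta_prod (R : realType) (L : discreteHypergroup R)
    (x : nat -> L) (s : seq nat) : {malg R[L]} :=
  \big[@hmul R L/<< hid >>]_(n <- s) << x n >>.

(* As x is injective, nonempty finite subsets F of its range correspond
   bijectively to nonempty strictly increasing lists of indices. *)
Definition ramsey_hypergroup (R : realType) (alpha : R)
    (L : discreteHypergroup R) : Prop :=
  infinite_set [set: L] /\
  forall (r : nat) (C : 'I_r -> set L), partition setT C setT ->
    exists (i : 'I_r) (x : nat -> L),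
      [/\ injective x, forall n, x n != hid &
          forall s : seq nat, s != [::] -> sorted ltn s ->
            alpha < mass (delta_prod x s) (C i)].

(* Main.v *)
(* The projection pi : K -> K//H turns convolution products into convolution
   products, so delta_F in K//H of a projected sequence is the pushforward of
   delta_F in K, and pulling a partition back along pi transfers the Ramsey
   property.  The only obstacle is that the projected sequence need not be
   injective or avoid [e]; but pi has finite fibers, so some subsequence does. *)

Require Import Defs.
From HB Require Import structures.
From mathcomp Require Import all_boot all_order all_algebra finmap.
From mathcomp Require Import boolp classical_sets functions cardinality reals.
From mathcomp Require Import monalg.

Set Implicit Arguments.
Unset Strict Implicit.
Unset Printing Implicit Defensive.

Import Order.TTheory GRing.Theory Num.Theory.
Local Open Scope classical_set_scope.
Local Open Scope ring_scope.

(** Each entry of [s] is hit at finitely many indices only, so [g] is eventually past the last of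
    them. *)
Lemma eventually_notin (T : eqType) (g : nat -> T) (s : seq T) :
  (forall t, finite_set (g @^-1` [set t])) ->
  exists M, forall m, (M <= m)%N -> g m \notin s.
Proof.
move=> gfin; elim: s => [|t s [M sM]]; first by exists 0%N.
have /finite_fsetP[B tB] := gfin t.
(* [B] is the fiber over [t]; the successor puts the bound strictly beyond its largest index. *)
exists (maxn M (\max_(i <- enum_fset B) i).+1) => m.
rewrite geq_max => /andP[/sM gms Bm]; rewrite inE negb_or gms andbT.
apply/eqP => gmt; have : [set` B] m by rewrite -tB.
by move=> mB; move: Bm; rewrite ltnNge leq_bigmax_seq.
Qed.

(** Greedy choice: [f N] lies past [N], and from there on [g] avoids both [e] and [g N]; iterating
    [f] gives [phi]. *)
Lemma finite_fibers_injective_subsequence (T : eqType) (e : T) (g : nat -> T) :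
  (forall t, finite_set (g @^-1` [set t])) ->
  exists phi : nat -> nat,
    [/\ {homo phi : m n / (m < n)%N}, injective (g \o phi) &
        forall n, g (phi n) != e].
Proof.
move=> gfin.
have /choice[f fP] N : exists M, (N < M)%N /\
    forall m, (M <= m)%N -> g m \notin [:: e; g N].
  have [M gM] := eventually_notin [:: e; g N] gfin.
  exists (maxn N.+1 M); split; first exact: leq_maxl.
  by move=> m; rewrite geq_max => /andP[_ /gM].
(* Starting at [f 0] rather than [0] makes the first term avoid [e] too. *)
pose phi k := iter k.+1 f 0%N.
have phi_lt : {homo phi : m n / (m < n)%N}.
  by apply: homo_ltn => [y x z|n]; [exact: ltn_trans | exact: (fP _).1].
have phi_neq m n : (m < n)%N -> g (phi n) != g (phi m).
  (* [f (phi m)] is [phi m.+1], and [phi] is monotone. *)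
  move=> mn; have le : (f (phi m) <= phi n)%N.
    by have := ltnW_homo phi_lt mn.
  by have := (fP _).2 _ le; rewrite !inE negb_or => /andP[].
exists phi; split=> // [m n /= gmn|n].
- by have [/phi_neq|/phi_neq|//] := ltngtP m n; rewrite gmn eqxx.
- by have := (fP (iter n f 0%N)).2 _ (leqnn _); rewrite !inE negb_or => /andP[].
Qed.

Section Quotient.
Variables (R : realType) (K : discreteHypergroup R).
Hypothesis commK : commutative_hypergroup K.
Variable H : set K.
Hypothesis subH : central_subgroup H.
Local Notation pi := (coset_pi H).
Local Notation L := (quotient_hypergroup commK subH).

(** The fiber lies in the translate of [H] by a representative of [q]. *)
Lemma coset_pi_fiber_finite (q : cosets H) :
  finite_set H -> finite_set (pi @^-1` [set q]).
Proof.
move=> Hfin; apply: sub_finite_set (finite_image (cmul (coset_rep q)) Hfin).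
move=> x; rewrite /= -{1}(coset_repK q) => /(coset_piP commK subH)[z Hz ->].
by exists z.
Qed.

Lemma quotient_infinite :
  finite_set H -> infinite_set [set: K] -> infinite_set [set: L].
Proof.
move=> Hfin Kinf Lfin; apply: Kinf.
apply: (@sub_finite_set _ _ (\bigcup_(q in [set: cosets H]) (pi @^-1` [set q]))).
  by move=> x _; exists (pi x).
by apply: bigcup_finite => // q _; exact: coset_pi_fiber_finite.
Qed.

Lemma delta_prod_quotient (x : nat -> K) (s : seq nat) :
  delta_prod (L := L) (fun n => pi (x n)) s = pushforward pi (delta_prod x s).
Proof.
rewrite /delta_prod; elim: s => [|n s IHs].
  by rewrite !big_nil (pushforwardU R pi).
rewrite !big_cons IHs (pushforward_hmul commK subH).
by rewrite (pushforwardU R pi).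
Qed.

Lemma partition_preimage_pi (r : nat) (C : 'I_r -> set (cosets H)) :
  partition setT C setT -> partition setT (fun i => pi @^-1` (C i)) setT.
Proof.
move=> [Ccov Ctriv Cne]; split.
- by rewrite /cover -preimage_bigcup -/(cover setT C) Ccov preimage_setT.
- move=> i j _ _ [x [Ci Cj]]; apply: (Ctriv i j) => //.
  by exists (pi x).
(* Pulled-back blocks stay nonempty because [pi] is surjective. *)
- by move=> i /Cne[q Cq]; exists (coset_rep q); rewrite /= coset_repK.
Qed.

End Quotient.

Theorem theorem4p7 (R : realType) (alpha : R) (K : discreteHypergroup R)
    (commK : commutative_hypergroup K) (H : set K) (subH : central_subgroup H) :
  0 <= alpha < 1 -> finite_set H ->
  ramsey_hypergroup alpha K ->
  ramsey_hypergroup alpha (quotient_hypergroup commK subH).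
Proof.
move=> _ Hfin [Kinf Kramsey]; split; first exact: quotient_infinite.
move=> r C /(partition_preimage_pi (H := H)) /Kramsey[i [x [xinj _ xC]]].
have fibers q : finite_set ((coset_pi H \o x) @^-1` [set q]).
  (* An injective [x] pulls the finite fibers of [pi] back to finite sets of indices. *)
  rewrite comp_preimage; apply: finite_preimage; first exact: in2W.
  exact: coset_pi_fiber_finite.
have [phi [phi_lt inj_phi phi_ne]] :=
  finite_fibers_injective_subsequence (coset_pi H hid) fibers.
exists i, (fun n => coset_pi H (x (phi n))); split=> // s s0 s_sorted.
rewrite (delta_prod_quotient commK subH (x \o phi)) pushforward_mass.
(* Since [phi] is strictly increasing, [map phi s] is again an increasing index list, so the bound
   for [x] applies to it. *)
have -> : delta_prod (x \o phi) s = delta_prod x (map phi s).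
  by rewrite /delta_prod big_map.
apply: xC; first by case: s s0 {s_sorted}.
exact: homo_sorted s_sorted.
Qed.
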